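(* For every $n\ge 2$, $E(\mathbf{C}_n\times\overleftrightarrow{K_2})=E(C_n\times\overleftrightarrow{K_2})=2n$. Moreover, $\mathbf{C}_n\times\overleftrightarrow{K_2}$ and $C_n\times\overleftrightarrow{K_2}$ are noncospectral sidigraphs with $2n$ vertices.
   Context: A sidigraph (signed digraph) is a pair $S=(D,\sigma)$, where $D=(V,\mathscr{A})$ is a digraph and $\sigma:\mathscr{A}\to\{-1,1\}$. Its adjacency matrix $A(S)=(a_{ij})$ has $a_{ij}=\sigma(v_i,v_j)$ if there is an arc from $v_i$ to $v_j$ and $0$ otherwise. The energy of $S$ is $E(S)=\sum_j|\Re z_j|$, where the $z_j$ are the eigenvalues of $A(S)$ with multiplicity. Two sidigraphs on the same number of vertices are cospectral if they have the same spectrum (with multiplicities). $C_n$ (respectively $\mathbf{C}_n$) is a signed directed cycle on $n$ vertices for which the product of the signs of its arcs is $+1$ (respectively $-1$). $\overleftrightarrow{K_2}$ is the symmetric digraph on two vertices $u,v$ with arcs $(u,v)$ and $(v,u)$, both positive. The cartesian product $S_1\times S_2$ of $S_1=(V_1,A_1,\sigma_1)$ and $S_2=(V_2,A_2,\sigma_2)$ is the sidigraph on $V_1\times V_2$ with an arc from $(u_i,v_j)$ to $(u_k,v_l)$ iff either $j=l$ and $(u_i,u_k)\in A_1$ (with sign $\sigma_1(u_i,u_k)$), or $i=k$ and $(v_j,v_l)\in A_2$ (with sign $\sigma_2(v_j,v_l)$). *)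

(* Defs.v *)
From HB Require Import structures.
From mathcomp Require Import all_boot all_order all_algebra.

Set Implicit Arguments.
Unset Strict Implicit.
Unset Printing Implicit Defensive.

Import Order.TTheory GRing.Theory Num.Theory.
Local Open Scope ring_scope.

(* Digraphs are finite and simple: at most one arc from u to v, and no loops.
   The value of [sign] outside the arcs is irrelevant. *)
Record sidigraph := Sidigraph {
  vertex :> finType;
  arc : rel vertex;
  sign : vertex -> vertex -> int;
  arc_irr : irreflexive arc;
  signP : forall u v, arc u v -> sign u v = 1 \/ sign u v = -1
}.

Arguments arc : clear implicits.
Arguments sign : clear implicits.

(* C stands for the complex numbers; every [numClosedFieldType] (e.g. [algC],
   or R[i] for R real closed) is allowed. *)
Definition adjacency (C : numClosedFieldType) (S : sidigraph) : 'M[C]_#|S| :=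
  \matrix_(i, j) (let u := enum_val i in let v := enum_val j in
                  if arc S u v then (sign S u v)%:~R else 0).

(* All roots of the characteristic polynomial, repeated according to
   multiplicity; only determined up to permutation. *)
Definition spectrum (C : numClosedFieldType) (S : sidigraph) : seq C :=
  sval (closed_field_poly_normal (char_poly (adjacency C S))).

Definition energy (C : numClosedFieldType) (S : sidigraph) : C :=
  \sum_(z <- spectrum C S) `|'Re z|.

Definition cospectral (C : numClosedFieldType) (S1 S2 : sidigraph) : Prop :=
  #|S1| = #|S2| /\ perm_eq (spectrum C S1) (spectrum C S2).

(* The sequence c lists every vertex exactly once, and the arcs are those from
   each vertex to its cyclic successor in c. *)
Definition directed_cycle (n : nat) (S : sidigraph) : Prop :=
  exists c : seq S,
    [/\ uniq c, size c = n, forall u, u \in c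
      & forall u v, arc S u v = (v == next c u)].

Definition sign_product (S : sidigraph) : int :=
  \prod_(a : S * S | arc S a.1 a.2) sign S a.1 a.2.

Definition positive_cycle (n : nat) (S : sidigraph) : Prop :=
  directed_cycle n S /\ sign_product S = 1.

Definition negative_cycle (n : nat) (S : sidigraph) : Prop :=
  directed_cycle n S /\ sign_product S = -1.

Definition K2_arc : rel bool := fun u v => u != v.

Fact K2_arc_irr : irreflexive K2_arc.
Proof. by move=> u; rewrite /K2_arc eqxx. Qed.

Fact K2_signP (u v : bool) : K2_arc u v -> 1 = 1 :> int \/ 1 = -1 :> int.
Proof. by left. Qed.

Definition symK2 : sidigraph :=
  @Sidigraph bool K2_arc (fun _ _ => 1) K2_arc_irr K2_signP.

Section CartesianProduct.

Variables S1 S2 : sidigraph.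

Definition cart_arc : rel (S1 * S2)%type := fun p q =>
  (p.2 == q.2) && arc S1 p.1 q.1 || (p.1 == q.1) && arc S2 p.2 q.2.

(* As there are no loops, the two kinds of arcs are disjoint, and an arc is of
   the first kind exactly when its second components agree. *)
Definition cart_sign (p q : S1 * S2) : int :=
  if p.2 == q.2 then sign S1 p.1 q.1 else sign S2 p.2 q.2.

Fact cart_arc_irr : irreflexive cart_arc.
Proof. by move=> p; rewrite /cart_arc !arc_irr !andbF. Qed.

Fact cart_signP p q :
  cart_arc p q -> cart_sign p q = 1 \/ cart_sign p q = -1.
Proof.
rewrite /cart_arc /cart_sign; case: eqP => [-> | _] /=.
  by rewrite arc_irr andbF orbF; apply: signP.
by case/andP=> _; apply: signP.
Qed.

Definition cartesian : sidigraph :=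
  @Sidigraph (S1 * S2)%type cart_arc cart_sign cart_arc_irr cart_signP.

End CartesianProduct.

(* Main.v *)
(* The spectrum of a directed n-cycle with sign product s consists of the roots
   of X^n - s, and taking the product with K2 replaces each eigenvalue z by
   z + 1 and z - 1. As |z| = 1, each pair contributes |Re z + 1| + |Re z - 1| = 2
   to the energy. The value 2 separates the two spectra: it is an eigenvalue of
   the product iff s = 1 or s = 3^n. *)

Require Import Defs.
From HB Require Import structures.
From mathcomp Require Import all_boot all_order all_algebra.
From mathcomp Require Import ring.

Set Implicit Arguments.
Unset Strict Implicit.
Unset Printing Implicit Defensive.

Import Order.TTheory GRing.Theory Num.Theory.
Local Open Scope ring_scope.

(** * Characteristic polynomials of similar, block diagonal and shifted matrices *)

Lemma char_poly_similar (R : comNzRingType) (m n : nat) (A : 'M[R]_m)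
    (B : 'M[R]_n) (P : 'M[R]_(m, n)) (Q : 'M[R]_(n, m)) :
  m = n -> P *m Q = 1%:M -> A *m P = P *m B -> char_poly A = char_poly B.
Proof.
(* The sizes to be compared later are equal but not convertible. Identifying them makes [P] square,
   and [P *m Q = 1%:M] then makes its determinant a unit, which cancels from the determinants of (X
   - A) P = P (X - B). *)
move=> eq_mn; case: n / eq_mn in B P Q * => PQ1 APB.
have cP : char_poly_mx A *m map_mx polyC P = map_mx polyC P *m char_poly_mx B.
  rewrite /char_poly_mx mulmxBl mulmxBr -!map_mxM APB.
  by rewrite mul_scalar_mx mul_mx_scalar.
have dP : \det (map_mx polyC P) * \det (map_mx polyC Q) = 1.
  by rewrite -det_mulmx -map_mxM PQ1 map_mx1 det1.
rewrite /char_poly -[LHS]mulr1 -dP mulrA -det_mulmx cP det_mulmx.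
by rewrite mulrAC dP mul1r.
Qed.

Lemma char_poly_diag_block (R : comNzRingType) (m n : nat) (A : 'M[R]_m)
    (B : 'M[R]_n) :
  char_poly (block_mx A 0 0 B) = char_poly A * char_poly B.
Proof.
rewrite /char_poly /char_poly_mx map_block_mx !map_mx0 scalar_mx_block.
by rewrite opp_block_mx add_block_mx !oppr0 !addr0 det_ublock.
Qed.

(** X - (A + a) = (X - a) - A, and substituting X - a for X is a ring morphism, so it commutes with
    the determinant. *)
Lemma char_poly_add_scalar (R : comNzRingType) (n : nat) (A : 'M[R]_n) (a : R) :
  char_poly (A + a%:M) = char_poly A \Po ('X - a%:P).
Proof.
rewrite /char_poly -[RHS](det_map_mx (comp_poly _)); congr (\det _).
apply/matrixP=> i j.
rewrite !mxE /= comp_polyB comp_polyC rmorphMn /= comp_polyX polyCD polyCMn.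
by rewrite mulrnBl opprD addrA addrAC.
Qed.

Lemma next_nth_mod (T : eqType) (x : T) (c : seq T) (i : nat) :
  uniq c -> (i < size c)%N -> next c (nth x c i) = nth x c (i.+1 %% size c).
Proof.
move=> uc lic; rewrite next_nth mem_nth //.
case: c uc lic => // y c uc lic; rewrite index_uniq //.
move: lic; rewrite /= ltnS leq_eqVlt => /orP[/eqP-> | lic].
  (* [next_nth] looks up the tail [c] with default value the head [y]; the last index runs off the
     tail and so returns [y], the entry at index 0. *)
  by rewrite modnn nth_default.
by rewrite modn_small ?ltnS // (set_nth_default x).
Qed.

(** * Signed directed cycles *)

Section Sidigraphs.

Variable C : numClosedFieldType.
Implicit Type S : sidigraph.

Definition arc_weight S (u v : S) : C :=
  if Defs.arc S u v then (sign S u v)%:~R else 0.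

Lemma sum_enum_val (T : finType) (F : T -> C) :
  \sum_(i < #|T|) F (enum_val i) = \sum_x F x.
Proof. by rewrite -big_enum_val; apply: eq_bigl. Qed.

Lemma sum_delta (T : finType) (a : T) (F : T -> C) :
  \sum_x (x == a)%:R * F x = F a.
Proof.
rewrite (bigD1 a) //= eqxx mul1r big1 ?addr0 // => x /negbTE->.
by rewrite mul0r.
Qed.

Lemma card_directed_cycle (n : nat) S : directed_cycle n S -> #|S| = n.
Proof.
case=> c [uc <- memc _]; rewrite -(card_uniqP uc).
by apply: eq_card => u; rewrite memc.
Qed.

(* Conjugating by the diagonal matrix of the partial sign products g makes every
   sign 1 except that of the closing arc, which becomes the sign product; this
   is the companion matrix of X^n - s. *)
Lemma char_poly_cycle (n : nat) S :
    (0 < n)%N -> directed_cycle n S ->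
  char_poly (adjacency C S) = 'X^n - (sign_product S)%:~R%:P.
Proof.
move=> n_gt0 cS; have card_S := card_directed_cycle cS.
have [c [uc sc memc arcE]] := cS.
have [x0 _] : exists x0 : S, true.
  by case: (c) sc n_gt0 => [<- | x0] //; exists x0.
pose v := nth x0 c.
pose t i := sign S (v i) (v (i.+1 %% n)%N).
pose g k := \prod_(i < k) t i.
have nextE i : (i < n)%N -> next c (v i) = v (i.+1 %% n)%N.
  by move=> lin; rewrite next_nth_mod ?sc.
have v_inj i j : (i < n)%N -> (j < n)%N -> (v i == v j) = (i == j).
  by move=> li lj; rewrite nth_uniq ?sc.
have t2 i : (i < n)%N -> t i * t i = 1.
  move=> lin; have : Defs.arc S (v i) (v (i.+1 %% n)%N) by rewrite arcE nextE.
  by rewrite /t => /signP[] ->.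
have gS k : g k.+1 = g k * t k by rewrite /g big_ord_recr.
have g2 k : (k <= n)%N -> g k * g k = 1.
  elim: k => [|k IH] lkn; first by rewrite /g big_ord0 mulr1.
  by rewrite gS mulrACA IH ?t2 ?mulr1 // ltnW.
have signE : sign_product S = g n.
  rewrite /sign_product -(pair_big_dep xpredT (Defs.arc S) (sign S)) /=.
  rewrite (eq_bigr (fun u => sign S u (next c u))); last first.
    by move=> u _; rewrite (big_pred1 (next c u)).
  transitivity (\prod_(u <- c) sign S u (next c u)).
    by rewrite [RHS]big_uniq //=; apply: eq_bigl => u; rewrite memc.
  rewrite (big_nth x0) sc big_mkord; apply: eq_bigr => i _.
  by rewrite nextE.
set s := sign_product S in signE *.
pose p : {poly C} := 'X^n - s%:~R%:P.
have sz_p : (size p).-1 = n by rewrite size_XnsubC.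
have p_mon : p \is monic by rewrite monicXnsubC.
rewrite -/p -(companionmxK p_mon).
(* A signed permutation matrix: it passes from the enumeration of the vertices to their order along
   the cycle, with signs [g]. It is orthogonal, so [P^T] is its inverse. *)
pose P : 'M[C]_(#|S|, (size p).-1) :=
  \matrix_(i, j) ((enum_val i == v j)%:R * (g j)%:~R).
have ord_lt (j : 'I_(size p).-1) : (j < n)%N by rewrite -[X in (_ < X)%N]sz_p.
have exists_index (u : S) : exists i : 'I_(size p).-1, u = v i.
  have lu : (index u c < (size p).-1)%N by rewrite sz_p -sc index_mem.
  by exists (Ordinal lu); rewrite /v nth_index.
apply: (@char_poly_similar _ _ _ _ _ P P^T); first by rewrite card_S sz_p.
  apply/matrixP=> i k; rewrite !mxE.
  have [a ua] := exists_index (enum_val i).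
  rewrite (bigD1 a) //= big1 ?addr0 => [|j /negbTE ja]; rewrite !mxE ua.
    rewrite eqxx mul1r mulrCA -rmorphM /= g2 ?mulr1; last exact/ltnW.
    by rewrite -ua eq_sym (inj_eq enum_val_inj).
  by rewrite v_inj // eq_sym -val_eqE in ja *; rewrite ja !mul0r.
apply/matrixP=> i j; rewrite !mxE.
under eq_bigr do rewrite !mxE mulrCA.
rewrite (sum_enum_val (fun w => (w == v j)%:R *
  (arc_weight (enum_val i) w * (g j)%:~R))) sum_delta.
have [a ua] := exists_index (enum_val i).
rewrite ua (bigD1 a) //=.
rewrite big1 ?addr0 => [|k /negbTE ka]; rewrite !mxE ?ua; last first.
  by rewrite v_inj // eq_sym -val_eqE in ka *; rewrite ka !mul0r.
have mod_lt : (a.+1 %% n < n)%N by rewrite ltn_mod.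
rewrite eqxx mul1r /arc_weight arcE nextE // v_inj //.
rewrite [(size p).-1.-1](congr1 predn sz_p).
rewrite coefB coefXn coefC (ltn_eqF (ord_lt j)) sub0r opprK.
(* The last row of the companion matrix holds the negated low coefficients of X^n - s, that is, s in
   column 0. It matches the closing arc because s = g a * t a and g a squares to 1. *)
have := ord_lt a; rewrite leq_eqVlt => /orP[/eqP an | lan].
  have -> : (a : nat) == n.-1 by rewrite -an.
  rewrite an modnn; case: eqP => [j0 | _]; last by rewrite mul0r mulr0.
  rewrite j0 -!rmorphM signE -an gS mulrA g2 ?mul1r; last by rewrite ltnW.
  by rewrite /g big_ord0 mulr1 /t an modnn.
(* In the other rows only column a + 1 is nonzero, and there t a * g (a + 1) = g a. *)
have -> : ((a : nat) == n.-1) = false.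
  by apply/negbTE; rewrite -eqSS prednK // ltn_eqF.
rewrite modn_small // [_.+1 == _]eq_sym; case: eqP => [ja | _].
  rewrite ja mulr1 -rmorphM gS; congr (_%:~R).
  by rewrite -{1}(modn_small lan) -/(t a) mulrCA t2 // mulr1.
by rewrite mul0r mulr0.
Qed.

(** * The product with K2 and its characteristic polynomial *)

Lemma card_cartesian_symK2 S : #|cartesian S symK2| = (2 * #|S|)%N.
Proof. by rewrite card_prod card_bool mulnC. Qed.

(* Over the two vertices of K2, (1, 1) and (1, -1) are eigenvectors for the
   eigenvalues 1 and -1, so the adjacency matrix of the product is similar to
   the block diagonal matrix with blocks A + 1 and A - 1. *)
Lemma char_poly_cartesian_symK2 S :
  char_poly (adjacency C (cartesian S symK2)) =
  (char_poly (adjacency C S) \Po ('X - 1%:P)) *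
  (char_poly (adjacency C S) \Po ('X - (-1)%:P)).
Proof.
rewrite -!char_poly_add_scalar -char_poly_diag_block.
(* [h false] and [h true] are the eigenvectors (1, 1) and (1, -1) of K2, and [K e] is the Kronecker
   product of the identity with [h e]. *)
pose h (e b : bool) : C := (-1) ^+ (e && b).
pose K e : 'M[C]_(#|cartesian S symK2|, #|S|) :=
  \matrix_(p, j) (((enum_val p).1 == enum_val j)%:R * h e (enum_val p).2).
have AK e : adjacency C (cartesian S symK2) *m K e =
            K e *m (adjacency C S + ((-1) ^+ e)%:M).
  apply/matrixP=> p j; rewrite !mxE.
  under eq_bigr do rewrite !mxE mulrCA.
  rewrite (sum_enum_val (fun q : S * bool => (q.1 == enum_val j)%:R *
    (@arc_weight (cartesian S symK2) (enum_val p) q * h e q.2))).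
  under [RHS]eq_bigr => k _.
    rewrite !mxE -(inj_eq enum_val_inj) -mulrA eq_sym.
  over.
  rewrite (sum_enum_val (fun w => (w == (enum_val p).1)%:R *
   (h e (enum_val p).2 * (arc_weight w (enum_val j) +
     (-1) ^+ e *+ (w == enum_val j))))) sum_delta.
  case: (enum_val p) => u b /=; set w := enum_val j.
  rewrite -(pair_bigA _ (fun x y => (x == w)%:R *
    (@arc_weight (cartesian S symK2) (u, b) (x, y) * h e y))) /=.
  under eq_bigr do rewrite -mulr_sumr.
  rewrite (sum_delta w (fun x => \sum_y
    (@arc_weight (cartesian S symK2) (u, b) (x, y) * h e y))).
  rewrite big_bool /arc_weight /= /cart_arc /cart_sign /K2_arc /= /h.
  (* If u = w, only the K2 arc remains: it flips b and so multiplies [h e] by (-1)^e. Otherwise only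
     the arc of [S] can remain, and it keeps b. *)
  have [-> | _] := eqVneq u w; case: b; case: e; rewrite /= ?arc_irr /=;
    rewrite ?orbF ?orbT ?andbF ?expr0 ?expr1 ?mulr0 ?mulr1 ?mulr0n ?mulr1n /=;
    try ring; case: ifP => _ /=; ring.
pose P := row_mx (K false) (K true).
(* The vectors (1, 1) and (1, -1) are orthogonal of squared length 2, whence the factor 1/2. *)
apply: (@char_poly_similar _ _ _ _ _ P (2^-1 *: P^T)).
- by rewrite card_cartesian_symK2 mul2n addnn.
- rewrite -scalemxAr tr_row_mx mul_row_col; apply/matrixP=> p q.
  have KK e : (K e *m (K e)^T) p q = ((enum_val p).1 == (enum_val q).1)%:R *
      (h e (enum_val p).2 * h e (enum_val q).2).
    rewrite !mxE; under eq_bigr => k _.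
      rewrite !mxE mulrACA -mulrA [_ == enum_val k]eq_sym.
    over.
    rewrite (sum_enum_val (fun w => (w == (enum_val p).1)%:R *
      (((enum_val q).1 == w)%:R * (h e (enum_val p).2 * h e (enum_val q).2)))).
    by rewrite sum_delta eq_sym.
  rewrite [LHS]mxE [X in _ * X]mxE !KK mxE -(inj_eq enum_val_inj) /h.
  case: (enum_val p) (enum_val q) => u b [u' b'] /=.
  rewrite xpair_eqE; case: (u == u'); case: b; case: b' => /=;
    rewrite ?expr0 ?expr1; by field.
by rewrite mul_mx_row mul_row_block !mulmx0 addr0 add0r !AK.
Qed.

(** * Spectrum and energy of the product *)

Lemma prod_XsubC_comp (rs : seq C) (a : C) :
  (\prod_(z <- rs) ('X - z%:P)) \Po ('X - a%:P) =
  \prod_(z <- [seq y + a | y <- rs]) ('X - z%:P).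
Proof.
rewrite big_map rmorph_prod; apply: eq_bigr => z _ /=.
by rewrite comp_polyB comp_polyX comp_polyC polyCD opprD addrAC addrA.
Qed.

Lemma char_poly_spectrum S :
  char_poly (adjacency C S) = \prod_(z <- spectrum C S) ('X - z%:P).
Proof.
rewrite /spectrum; case: closed_field_poly_normal => rs /= {1}->.
by rewrite (monicP (char_poly_monic _)) scale1r.
Qed.

Lemma spectrum_cartesian_symK2 S :
  perm_eq (spectrum C (cartesian S symK2))
    ([seq z + 1 | z <- spectrum C S] ++ [seq z - 1 | z <- spectrum C S]).
Proof.
apply: prod_XsubC_eq; rewrite -char_poly_spectrum char_poly_cartesian_symK2.
by rewrite char_poly_spectrum !prod_XsubC_comp big_cat.
Qed.

Lemma size_spectrum S : size (spectrum C S) = #|S|.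
Proof.
apply: succn_inj.
by rewrite -(size_char_poly (adjacency C S)) char_poly_spectrum size_prod_XsubC.
Qed.

(** As Re z lies in [-1, 1], the absolute values open to (Re z + 1) + (1 - Re z). *)
Lemma normr_Re_add1_sub1 (z : C) :
  `|z| <= 1 -> `|'Re (z + 1)| + `|'Re (z - 1)| = 2.
Proof.
move=> z1; have : `|'Re z| <= 1.
  by apply: le_trans z1; apply: leif_normC_Re_Creal.
rewrite real_ler_norml ?Creal_Re // => /andP[z_ge z_le].
rewrite !raddfD raddfN /= (Creal_ReP 1 _) ?rpred1 //.
rewrite ger0_norm -?lerBlDr ?sub0r // ler0_norm ?subr_le0 //; ring.
Qed.

Lemma mem_spectrum_cycle (n : nat) S (z : C) :
    (0 < n)%N -> directed_cycle n S ->
  (z \in spectrum C S) = (z ^+ n == (sign_product S)%:~R).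
Proof.
move=> n_gt0 cS; rewrite -root_prod_XsubC -char_poly_spectrum.
by rewrite (char_poly_cycle n_gt0 cS) /root !hornerE subr_eq0.
Qed.

Lemma energy_cycle_cartesian_symK2 (n : nat) S :
    (0 < n)%N -> directed_cycle n S -> `|sign_product S| = 1 ->
  energy C (cartesian S symK2) = (2 * n)%:R.
Proof.
move=> n_gt0 cS sS.
rewrite /energy (perm_big _ (spectrum_cartesian_symK2 S)) big_cat !big_map /=.
rewrite -big_split /= (eq_big_seq (fun=> 2)).
  rewrite big_const_seq count_predT size_spectrum (card_directed_cycle cS).
  by rewrite iter_addr_0 natrM mulr_natr.
move=> z; rewrite (mem_spectrum_cycle _ n_gt0 cS) => /eqP zn.
apply: normr_Re_add1_sub1.
by rewrite -(expr_le1 n_gt0) // -normrX zn -intr_norm sS.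
Qed.

(** Since 2 = 1 + 1 = 3 - 1, the eigenvalue 2 can only come from an eigenvalue 1 or 3 of the cycle,
    that is, from 1^n = s or 3^n = s. *)
Lemma mem2_spectrum_cycle_cartesian_symK2 (n : nat) S :
    (0 < n)%N -> directed_cycle n S ->
  (2 \in spectrum C (cartesian S symK2)) =
  (sign_product S == 1) || (sign_product S == 3 ^+ n).
Proof.
move=> n_gt0 cS; rewrite (perm_mem (spectrum_cartesian_symK2 S)) mem_cat.
have in1 : (2 \in [seq z + 1 | z <- spectrum C S]) = (1 \in spectrum C S).
  exact: (mem_map (@addIr C 1)).
have in3 : (2 \in [seq z - 1 | z <- spectrum C S]) = (3 \in spectrum C S).
  have -> : 2 = 3 - 1 :> C by ring.
  exact: (mem_map (@addIr C (-1))).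
rewrite in1 in3 !(mem_spectrum_cycle _ n_gt0 cS) expr1n.
by rewrite -!(eqr_int C) rmorphXn /= [1 == _]eq_sym [_ ^+ n == _]eq_sym.
Qed.

End Sidigraphs.

Theorem corollary6p2 (C : numClosedFieldType) (n : nat) (Cn bCn : sidigraph)
    (n_ge2 : (2 <= n)%N)
    (CnP : positive_cycle n Cn) (bCnP : negative_cycle n bCn) :
  [/\ energy C (cartesian bCn symK2) = energy C (cartesian Cn symK2),
      energy C (cartesian Cn symK2) = (2 * n)%:R,
      #|cartesian bCn symK2| = (2 * n)%N,
      #|cartesian Cn symK2| = (2 * n)%N
    & ~ cospectral C (cartesian bCn symK2) (cartesian Cn symK2)].
Proof.
have n_gt0 : (0 < n)%N by apply: ltnW.
case: CnP bCnP => cC sC [cB sB].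
split.
- by rewrite !(@energy_cycle_cartesian_symK2 C n) ?sC ?sB.
- by rewrite (@energy_cycle_cartesian_symK2 C n) ?sC.
- by rewrite card_cartesian_symK2 (card_directed_cycle cB).
- by rewrite card_cartesian_symK2 (card_directed_cycle cC).
case=> _ /perm_mem/(_ 2).
rewrite (mem2_spectrum_cycle_cartesian_symK2 C n_gt0 cC).
rewrite (mem2_spectrum_cycle_cartesian_symK2 C n_gt0 cB) sC sB.
(* Cospectrality would make 2 an eigenvalue for s = -1 too, forcing -1 = 1 or -1 = 3^n; the latter
   fails by sign. *)
rewrite eqxx orTb => /orP[// | /eqP m1].
by have := exprn_ge0 n (ler0n int 3); rewrite -m1.
Qed.
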